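(* Let $K$ be a local field with valuation $\mathrm{val}$ and module $q$. Let $X$ be a non-degenerate Gaussian vector in $K^2$ with lattice $L$ and let $V := \mathrm{val}(X)$ be its image under valuation. Define $\varphi_L : \mathbb{Z}^2 \to \mathbb{R}$ via $$\varphi_L(v) = -\log_q\big(\mathbb{P}(V \ge v)\big).$$ Then a function $\phi : \mathbb{Z}^2 \to \mathbb{R}$ equals $\varphi_L$ for some lattice $L$ (of a non-degenerate Gaussian vector in $K^2$) if and only if $\phi$ is the restriction to $\mathbb{Z}^2$ of a tropical polynomial $P : \mathbb{R}^2 \to \mathbb{R}$ given by $$P(v) = \max\big(c_{00},\ v_1 - c_{10},\ v_2 - c_{01},\ v_1 + v_2 - c_{11}\big),$$ where $c_{00} = 0$ and $$c_{00} + c_{11} \ge c_{01} + c_{10}.$$ In other words, $P$ is supported on the discrete cube $\{0,1\}^2$ with supermodular coefficients.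
   Context: A (non-archimedean) local field $K$ is a locally compact, non-discrete, totally disconnected topological field. It carries a surjective discrete valuation $\mathrm{val}: K \to \mathbb{Z} \cup \{+\infty\}$; $\mathcal{O}_K = \{x \in K : \mathrm{val}(x) \ge 0\}$ is its valuation ring, and the module $q$ of $K$ is the (finite) cardinality of its residue field. A lattice in $K^d$ is a compact $\mathcal{O}_K$-submodule of $K^d$. The Gaussian distributions on $K^d$ are exactly the normalized Haar measures (uniform probability measures) on lattices in $K^d$, and the lattice of a Gaussian vector is the lattice supporting its distribution; a Gaussian is non-degenerate if its lattice has full rank $d$. For $x = (x_1,x_2) \in K^2$, $\mathrm{val}(x) = (\mathrm{val}(x_1), \mathrm{val}(x_2))$, and $V \ge v$ is meant coordinatewise. A tropical polynomial here is a maximum of finitely many terms, each a linear form in $v = (v_1,v_2)$ with non-negative integer coefficients (the exponent vector of the term) minus a constant (the coefficient of the term). It is supported on the discrete cube $\{0,1\}^2$ if its exponent vectors are the elements of $\{0,1\}^2$; the coefficients $c_{ij}$, $(i,j) \in \{0,1\}^2$, are supermodular if $c_{00} + c_{11} \ge c_{01} + c_{10}$.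
   Formalization: The coefficients c_ij are taken to be integers: with real coefficients such as c10 = c01 = 1/2, c11 = 1 the polynomial takes the value 1/2 at (1,0), while φ_L is always integer-valued. *)

(* Defs.v *)
From HB Require Import structures.
From mathcomp Require Import all_boot all_order all_algebra.
From mathcomp Require Import all_classical all_reals all_analysis.

Set Implicit Arguments.
Unset Strict Implicit.
Unset Printing Implicit Defensive.

Import Order.TTheory GRing.Theory Num.Theory.

Local Open Scope classical_set_scope.
Local Open Scope ring_scope.
Local Open Scope card_scope.

HB.mixin Record TopologicalZmodule_isTopologicalField K
    & TopologicalZmodule K & GRing.Field K := {
  mul_continuous : continuous (fun x : K * K => x.1 * x.2) ;
  inv_continuous : forall x : K, x != 0 ->
    {for x, continuous (GRing.inv : K -> K)}
}.

#[short(type="topologicalFieldType")]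
HB.structure Definition TopologicalField :=
  {K of TopologicalZmodule K & GRing.Field K
      & TopologicalZmodule_isTopologicalField K}.

HB.mixin Record TopologicalField_isLocalField K & TopologicalField K := {
  local_field_locally_compact : locally_compact [set: K] ;
  local_field_nondiscrete : (@nbhs K K) <> principal_filter ;
  local_field_totally_disconnected : totally_disconnected [set: K]
}.

#[short(type="localFieldType")]
HB.structure Definition LocalField :=
  {K of TopologicalField K & TopologicalField_isLocalField K}.

Section Valuation.
Variables (K : localFieldType) (val : K -> \bar int).
Local Open Scope ereal_scope.

(* The value group with infinity is [\bar int] without [-oo]. The last field
   says that [val] is a valuation of the local field, i.e. that it induces the
   topology of [K]. *)
Record is_normalized_valuation : Prop := IsNormalizedValuation {
  valuation_range : range val = [set z | z != -oo] ;
  valuation_infty : forall x, val x = +oo <-> x = 0%R ;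
  valuationM : forall x y, val (x * y)%R = val x + val y ;
  valuationD : forall x y, mine (val x) (val y) <= val (x + y)%R ;
  valuation_nbhs0 : forall U : set K,
    nbhs (0%R : K) U <-> exists n : int, [set x | n%:E <= val x] `<=` U
}.

Definition valuation_ring : set K := [set x | 0 <= val x].

(* The cosets [x + m] with [x] in the valuation ring, where [m] is the set of
   elements of positive valuation. *)
Definition residue_field : set (set K) :=
  [set [set y | 0 < val (y - x)%R] | x in valuation_ring].

Definition is_module (q : nat) : Prop := residue_field #= `I_q.

End Valuation.

Section Lattice.
Variables (K : localFieldType) (val : K -> \bar int) (n : nat).

Record is_lattice (L : set 'rV[K]_n) : Prop := IsLattice {
  lattice_compact : compact L ;
  lattice0 : L 0 ;
  latticeD : forall x y, L x -> L y -> L (x + y) ;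
  latticeZ : forall a x, valuation_ring val a -> L x -> L (a *: x)
}.

(* A torsion-free module has rank [n] in ['rV[K]_n] iff it contains [n]
   linearly independent vectors, here the rows of [B]. *)
Definition full_rank (L : set 'rV[K]_n) : Prop :=
  exists2 B : 'M[K]_n, (forall i, L (row i B)) & row_free B.

Definition val_vec (x : 'rV[K]_n) : 'rV[\bar int]_n := map_mx val x.

End Lattice.

(* An alias of ['rV[K]_n] pointed at 0: the base type of a measurable structure
   has to be pointed. *)
Definition pointed_rV (K : localFieldType) (n : nat) : Type := 'rV[K]_n.

HB.instance Definition _ K n := Choice.on (pointed_rV K n).
HB.instance Definition _ K n := isPointed.Build (pointed_rV K n) (0 : 'rV[K]_n).

Definition borel_rV (K : localFieldType) (n : nat) : set (set (pointed_rV K n)) :=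
  @open 'rV[K]_n.

Notation borelType K n := (g_sigma_algebraType (@borel_rV K n)).

Definition ge_vec (n : nat) (V : 'rV[\bar int]_n) (v : 'rV[int]_n) : Prop :=
  forall i, ((v ord0 i)%:E <= V ord0 i)%E.

Section Gaussian.
Variables (R : realType) (K : localFieldType) (val : K -> \bar int) (n : nat).

Definition is_normalized_haar (L : set 'rV[K]_n)
    (mu : {measure set (borelType K n) -> \bar R}) : Prop :=
  mu L = 1%E /\
  forall x (A : set (borelType K n)), L x -> measurable A ->
    mu [set x + y | y in (A : set 'rV[K]_n)] = mu A.

Variables (d : measure_display) (Omega : measurableType d).
Variables (P : probability Omega R) (X : {RV P >-> borelType K n}).

Definition gaussian_with_lattice (L : set 'rV[K]_n) : Prop :=
  is_lattice val L /\ is_normalized_haar L (distribution P X).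

Definition nondegenerate_gaussian_with_lattice (L : set 'rV[K]_n) : Prop :=
  gaussian_with_lattice L /\ full_rank L.

Definition logb (q : nat) (x : R) : R := ln x / ln q%:R.

Definition neg_log_tail (q : nat) (v : 'rV[int]_n) : R :=
  - logb q (fine (P [set w | ge_vec (val_vec val (X w)) v])).

End Gaussian.

(* Column [0] of [v] is the first coordinate; [cij] is the coefficient of the
   term with exponent vector [(i, j)]. *)
Definition cube_polynomial (R : realType) (c00 c10 c01 c11 : R)
    (v : 'rV[R]_2) : R :=
  Num.max (Num.max c00 (v 0 0 - c10))
          (Num.max (v 0 1 - c01) (v 0 0 + v 0 1 - c11)).

(* Main.v *)
(* A lattice [L] of full rank in the plane has a basis in Hermite form, [e] and
   [f] with [f 0 0 = 0]. Let [a] and [b] be the valuations of [e 0 0] and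
   [f 0 1], and let [m] be the minimum of [b] and the valuation of [e 0 1]. If
   [M] is a submodule of [L] and [c] the least valuation of an [i]-th coordinate
   on [M], then for [k >= c] the set of [x] in [M] with [val (x i) >= k] splits
   into [q] translates of its analogue for [k + 1], so translation invariance
   makes its measure drop by the factor [q] at each step. Applying this to the
   first coordinate and then to the second one gives
     phi v = d + max 0 (v2 - min (m + d) b),  where d = max 0 (v1 - a),
   which is the maximum of 0, v1 - a, v2 - m and v1 + v2 - (a + b);
   supermodularity of the coefficients is the inequality m <= b.

   Conversely, every triple [a, m, b] with [m <= b] comes from the image of the
   integer vectors under an invertible matrix, so it remains to construct a
   random integer vector whose law is invariant. Its expansion in powers of a
   uniformizer is read off the digits of a uniform point of [0, 1[, in the base
   given by the number of residue classes of integer vectors. *)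
Require Import Defs.
From HB Require Import structures.
From mathcomp Require Import all_boot all_order all_algebra.
From mathcomp Require Import all_classical all_reals all_analysis.
From mathcomp Require Import zify ring.

Set Implicit Arguments.
Unset Strict Implicit.
Unset Printing Implicit Defensive.

Import Order.TTheory GRing.Theory Num.Theory.

Local Open Scope classical_set_scope.
Local Open Scope ring_scope.

(** * Arithmetic of a normalized valuation and its residue field *)

Section ValuedField.
Variables (K : localFieldType) (val : K -> \bar int).
Hypothesis hval : is_normalized_valuation val.

Definition val_ge (k : int) (x : K) : bool := (k%:E <= val x)%E.

Lemma valuation0 : val 0 = +oo%E.
Proof. exact/(valuation_infty hval). Qed.

Lemma val_fin (x : K) : x != 0 -> exists k : int, val x = k%:E.
Proof.
move=> x0; have : val x != -oo%E.
  by have : range val (val x) by []; rewrite (valuation_range hval).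
case E : (val x) => [r| |] // _; first by exists r.
by move/(valuation_infty hval) : E x0 => ->; rewrite eqxx.
Qed.

Lemma valuation1 : val 1 = 0%E.
Proof.
have [k E] := val_fin (oner_neq0 K).
move: (valuationM hval 1 1); rewrite mulr1 E -EFinD => -[/eqP].
by rewrite -subr_eq0 opprD addrA subrr sub0r oppr_eq0 => /eqP ->.
Qed.

Lemma valuationN (x : K) : val (- x) = val x.
Proof.
have N10 : (-1 : K) != 0 by rewrite oppr_eq0 oner_neq0.
have [k E] := val_fin N10.
move: (valuationM hval (-1) (-1));
  rewrite mulN1r opprK valuation1 E -EFinD => -[/esym/eqP kk].
have k0 : k = 0 by move: kk => /eqP; lia.
by rewrite -mulN1r (valuationM hval) E k0 add0e.
Qed.

Lemma valuationV (x : K) (k : int) : val x = k%:E -> val x^-1 = (- k)%:E.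
Proof.
move=> E; have x0 : x != 0.
  by apply: contraPneq E => ->; rewrite valuation0.
have xV0 : x^-1 != 0 by rewrite invr_eq0.
have [j Ej] := val_fin xV0.
move: (valuationM hval x x^-1);
  rewrite mulfV // valuation1 E Ej -EFinD => -[jk].
by congr (_%:E); lia.
Qed.

Lemma exists_val (k : int) : exists x : K, val x = k%:E.
Proof.
have : [set z : \bar int | z != -oo%E] k%:E by [].
by rewrite -(valuation_range hval) => -[x _ <-]; exists x.
Qed.

(** A stand-in for the [k]-th power of a uniformizer. The choices for different [k] are independent,
    so only the valuation of [pval k] is known. *)
Definition pval (k : int) : K := projT1 (cid (exists_val k)).

Lemma val_pval k : val (pval k) = k%:E.
Proof. exact: (projT2 (cid (exists_val k))). Qed.

Lemma val_neq0 (x : K) (k : int) : val x = k%:E -> x != 0.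
Proof. by move=> E; apply: contraPneq E => ->; rewrite valuation0. Qed.

Lemma pval_neq0 k : pval k != 0.
Proof. exact: val_neq0 (val_pval k). Qed.

Lemma val_ge0 k : val_ge k 0.
Proof. by rewrite /val_ge valuation0 leey. Qed.

Lemma val_geE k x j : val x = j%:E -> val_ge k x = (k <= j).
Proof. by move=> E; rewrite /val_ge E lee_fin. Qed.

Lemma val_ge_pval k : val_ge k (pval k).
Proof. by rewrite (val_geE _ (val_pval k)). Qed.

Lemma val_geN k x : val_ge k (- x) = val_ge k x.
Proof. by rewrite /val_ge valuationN. Qed.

Lemma val_geD k x y : val_ge k x -> val_ge k y -> val_ge k (x + y).
Proof.
move=> hx hy; apply: le_trans (valuationD hval x y).
by rewrite le_min; apply/andP.
Qed.

Lemma val_geB k x y : val_ge k x -> val_ge k y -> val_ge k (x - y).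
Proof. by move=> hx hy; apply: val_geD => //; rewrite val_geN. Qed.

Lemma val_ge_le j k x : j <= k -> val_ge k x -> val_ge j x.
Proof. by move=> jk; apply: le_trans; rewrite lee_fin. Qed.

Lemma val_geM j k x y : val_ge j x -> val_ge k y -> val_ge (j + k) (x * y).
Proof. by move=> hx hy; rewrite /val_ge (valuationM hval) EFinD leeD. Qed.

Lemma val_geMl j k x y : val x = j%:E -> val_ge (j + k) (x * y) = val_ge k y.
Proof.
move=> E; apply/idP/idP => [h|]; last first.
  by apply: val_geM; rewrite /val_ge E.
have /val_geM/(_ h) : val_ge (- j) x^-1 by rewrite /val_ge (valuationV E).
by rewrite addKr mulKf // (val_neq0 E).
Qed.

Lemma val_ge1 x : val_ge 1 x = (0 < val x)%E.
Proof.
by rewrite /val_ge; case: (val x) => [r| |] //; rewrite ?lee_fin ?lte_fin; lia.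
Qed.

(** The axioms describe the neighbourhoods of 0 only; continuity of addition transports the
    description to every point. *)
Lemma nbhs_valP (x : K) (U : set K) :
  nbhs x U <-> exists k : int, forall y, val_ge k (y - x) -> U y.
Proof.
have tr (a b : K) (V : set K) : nbhs (b + a) V -> nbhs b [set y | V (y + a)].
  move=> hV.
  have add_cvg : (fun z : K * K => z.1 + z.2) z @[z --> (b, a)] --> b + a.
    exact: (@add_continuous K (b, a)).
  have pair_cvg : (fun z : K => (z, a)) z @[z --> b] --> (b, a).
    by apply: cvg_pair => //; exact: cvg_cst.
  exact: (cvg_comp _ _ pair_cvg add_cvg) V hV.
split=> [h|[k h]].
  have /tr : nbhs (0 + x) U by rewrite add0r.
  move=> /(valuation_nbhs0 hval)[k hk]; exists k => y hy.
  by rewrite -(subrK x y); exact: hk.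
have /tr : nbhs (x - x) [set y | U (y + x)].
  rewrite subrr; apply/(valuation_nbhs0 hval); exists k => y hy.
  by apply: h; rewrite addrK.
by apply: filterS => y /=; rewrite subrK.
Qed.

Variable q : nat.
Hypothesis hq : is_module val q.

(** A bijection between ['I_q] and the set of cosets, followed by a choice of one element in each
    coset. *)
Lemma residue_reps : exists c : 'I_q -> K,
  [/\ forall i, val_ge 0 (c i),
      forall x, val_ge 0 x -> exists i, val_ge 1 (x - c i) &
      forall i j, val_ge 1 (c i - c j) -> i = j].
Proof.
have /card_set_bijP[f [fun_f inj_f surj_f]] : (`I_q #= residue_field val)%card.
  by rewrite card_eq_sym.
have rep (i : 'I_q) : exists x, val_ge 0 x /\
    f i = [set y | (0 < val (y - x)%R)%E].
  have [x hx <-] := fun_f i (ltn_ord i).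
  by exists x.
have [c hc] := choice rep; exists c; split=> [i|x hx|i j hij].
- exact: (hc i).1.
- have : residue_field val [set y | (0 < val (y - x)%R)%E] by exists x.
  move=> /surj_f [i iq fi]; exists (Ordinal iq); rewrite val_ge1.
  have /= := (hc (Ordinal iq)).2; rewrite fi => /seteqP[+ _] => /(_ x); apply.
  by rewrite /= subrr valuation0.
- apply/val_inj/inj_f; rewrite ?inE /=; [exact: ltn_ord..|].
  rewrite (hc i).2 (hc j).2; apply/seteqP; split=> y /=;
    rewrite -!val_ge1 => hy.
    by rewrite -(subrK (c i) y) -addrA val_geD.
  by rewrite -(subrK (c j) y) -addrA val_geD // -val_geN opprB.
Qed.

(** The elements 0 and 1 lie in distinct residue classes because 1 has valuation 0. *)
Lemma module_gt1 : (1 < q)%N.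
Proof.
have [c [_ c_surj c_inj]] := residue_reps.
have [i hi] := c_surj 0 (val_ge0 0).
have v1 : val_ge 0 1 by rewrite /val_ge valuation1.
have [j hj] := c_surj 1 v1.
have : i != j.
  apply/eqP => ij; have : val_ge 1 (1 : K).
    by rewrite -(subrK (c j) 1) val_geD // -ij -val_geN -sub0r.
  by rewrite /val_ge valuation1.
by move: i j {hi hj} => [i hi] [j hj]; rewrite -val_eqE /=; lia.
Qed.

End ValuedField.

(** * Balls, topology and Borel sets in the space of row vectors *)

Section ValuedSpace.
Variables (K : localFieldType) (val : K -> \bar int).
Hypothesis hval : is_normalized_valuation val.
Variable n : nat.
Implicit Types (x y : 'rV[K]_n) (k : int).

(** The closed ball of radius [q^-k] about 0 for the sup norm: a larger [k] gives a smaller ball. *)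
Definition rball k : set 'rV[K]_n :=
  [set x | forall i, val_ge val k (x ord0 i)].

Lemma rball0 k : rball k 0.
Proof. by move=> i; rewrite mxE val_ge0. Qed.

Lemma rballD k x y : rball k x -> rball k y -> rball k (x + y).
Proof. by move=> hx hy i; rewrite mxE val_geD. Qed.

Lemma rballN k x : rball k x -> rball k (- x).
Proof. by move=> hx i; rewrite mxE val_geN. Qed.

Lemma rballC k x y : rball k (x - y) -> rball k (y - x).
Proof. by move=> /rballN; rewrite opprB. Qed.

Lemma rball_trans k x y z : rball k (x - y) -> rball k (y - z) ->
  rball k (x - z).
Proof. by move=> h1 h2; rewrite -(subrKA y); exact: rballD. Qed.

Lemma rball_le j k x : j <= k -> rball k x -> rball j x.
Proof. by move=> jk hx i; exact: val_ge_le (hx i). Qed.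

Lemma rballZ j k (a : K) x : val_ge val j a -> rball k x ->
  rball (j + k) (a *: x).
Proof. by move=> ha hx i; rewrite mxE val_geM. Qed.

Lemma rballZl j k (a : K) x : val a = j%:E ->
  rball (j + k) (a *: x) <-> rball k x.
Proof.
move=> E; split=> h i; last by rewrite mxE (val_geMl hval _ _ E).
by have := h i; rewrite mxE (val_geMl hval _ _ E).
Qed.

Lemma rball_bounded x : exists k, rball k x.
Proof.
have h (i : 'I_n) : exists k, val_ge val k (x ord0 i).
  have [->|/(val_fin hval)[k E]] := eqVneq (x ord0 i) 0.
    by exists 0; rewrite val_ge0.
  by exists k; rewrite (val_geE _ E).
have [k hk] := choice h.
exists (\big[Num.min/0]_i k i) => i; apply: val_ge_le (hk i).
exact: bigmin_le.
Qed.

Lemma nbhs_rowP x (U : set 'rV[K]_n) :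
  nbhs x U <-> exists k, forall y, rball k (y - x) -> U y.
Proof.
split=> [[P hP PU]|[k h]].
  have kP (i : 'I_n) : exists k, forall t, val_ge val k (t - x ord0 i) ->
    P ord0 i t.
    exact/(nbhs_valP hval)/hP.
  have [k hk] := choice kP.
  exists (\big[Num.max/0]_i k i) => y hy; apply: PU => /= i j.
  rewrite (ord1 i); apply: hk; have := hy j; rewrite !mxE.
  apply: val_ge_le; exact: le_bigmax.
exists (fun i j => [set t | val_ge val k (t - x i j)]) => [i j|y /= hy].
  by apply/(nbhs_valP hval); exists k.
by apply: h => j; rewrite !mxE; exact: hy.
Qed.

Lemma rball_invariant_open k (A : set 'rV[K]_n) :
  (forall x y, A x -> rball k (y - x) -> A y) -> open A.
Proof.
move=> hA; rewrite openE => x Ax; apply/nbhs_rowP; exists k => y.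
exact: hA.
Qed.

(** Balls shrink as [k] grows, so natural [k] suffice; this allows an open set to be exhausted by a
    sequence. *)
Lemma open_rowP (U : set 'rV[K]_n) : open U <->
  forall x, U x -> exists k : nat, forall y, rball k (y - x) -> U y.
Proof.
rewrite openE; split=> [h x /h /nbhs_rowP [k hk]|h x /h [k hk]].
  exists `|k|%N => y hy; apply: hk; apply: rball_le hy; lia.
by apply/nbhs_rowP; exists k%:Z.
Qed.

Lemma open_measurable_row (U : set 'rV[K]_n) :
  open U -> measurable (U : set (borelType K n)).
Proof. by move=> oU; exact: sub_sigma_algebra. Qed.

Lemma rball_invariant_measurable k (A : set 'rV[K]_n) :
  (forall x y, A x -> rball k (y - x) -> A y) ->
  measurable (A : set (borelType K n)).
Proof.
move=> hA; apply: open_measurable_row; exact: rball_invariant_open hA.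
Qed.

Lemma measurable_fun_row d (T : measurableType d) (f : T -> borelType K n) :
  (forall U : set 'rV[K]_n, open U -> measurable (f @^-1` U)) ->
  measurable_fun [set: T] f.
Proof.
move=> mf.
apply: (@measurability _ _ T (borelType K n) _ _ (@borel_rV K n)) => //.
by move=> _ [U oU <-]; rewrite setTI; exact: mf.
Qed.

Lemma measurable_subr x : measurable_fun [set: borelType K n]
  ((fun y : 'rV[K]_n => y - x) : borelType K n -> borelType K n).
Proof.
apply: measurable_fun_row => U oU; apply: open_measurable_row.
apply/open_rowP => y Uy; have [k hk] := (open_rowP _).1 oU _ Uy.
by exists k => z hz; apply: hk; rewrite opprB addrA subrK.
Qed.

Lemma measurable_translate x (A : set (borelType K n)) : measurable A ->
  measurable ([set x + y | y in (A : set 'rV[K]_n)] : set (borelType K n)).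
Proof.
move=> mA; pose f (y : borelType K n) : borelType K n := (y : 'rV[K]_n) - x.
have -> : [set x + y | y in (A : set 'rV[K]_n)] = f @^-1` A.
  apply/seteqP; split=> [_ [y Ay <-]|y /= Ay].
    by rewrite /f /= addrC addKr.
  by exists (f y) => //; rewrite /f addrC subrK.
by rewrite -[_ @^-1` _]setTI; exact: (measurable_subr x).
Qed.

End ValuedSpace.

(** * Decay of Haar measure along the filtration by one coordinate *)

Section HaarTail.
Variables (R : realType) (K : localFieldType) (val : K -> \bar int).
Hypothesis hval : is_normalized_valuation val.
Variable q : nat.
Hypothesis hq : is_module val q.
Variable n : nat.
Implicit Types (M : set 'rV[K]_n) (k : int).

(** The algebraic part of [is_lattice], which the slices [coord_ge] inherit without an argument
    about compactness. *)
Record submodule (M : set 'rV[K]_n) : Prop := Submodule {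
  submodule0 : M 0 ;
  submoduleD : forall x y, M x -> M y -> M (x + y) ;
  submoduleZ : forall a x, val_ge val 0 a -> M x -> M (a *: x)
}.

Lemma submoduleB M x y : submodule M -> M x -> M y -> M (x - y).
Proof.
move=> hM hx hy; apply: submoduleD => //; rewrite -scaleN1r.
by apply: submoduleZ => //; rewrite (val_geN hval) /val_ge (valuation1 hval).
Qed.

Lemma submodule_measurable M k : submodule M -> rball val k `<=` M ->
  measurable (M : set (borelType K n)).
Proof.
move=> hM kM; apply: (@rball_invariant_measurable _ _ hval _ k) => x y hx hy.
by rewrite -(subrK x y); apply: submoduleD => //; exact: kM.
Qed.

Definition coord_ge (i : 'I_n) (k : int) (M : set 'rV[K]_n) : set 'rV[K]_n :=
  [set x | M x /\ val_ge val k (x ord0 i)].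

Lemma coord_ge_submodule (i : 'I_n) k M : submodule M ->
  submodule (coord_ge i k M).
Proof.
move=> hM; split=> [|x y [hx kx] [hy ky]|a x ha [hx kx]].
- by split; [exact: submodule0|rewrite mxE val_ge0].
- by split; [exact: submoduleD|rewrite mxE val_geD].
- split; first exact: submoduleZ.
  by rewrite mxE -[k]add0r val_geM.
Qed.

Lemma coord_ge_rball i k j M :
  rball val j `<=` M -> rball val (Num.max j k) `<=` coord_ge i k M.
Proof.
move=> jM x hx; split; first by apply/jM/(rball_le _ hx); rewrite le_max lexx.
by apply: val_ge_le (hx i); rewrite le_max lexx orbT.
Qed.

Lemma coord_ge_le i k c M :
  (forall x : 'rV_n, M x -> val_ge val c (x ord0 i)) ->
  k <= c -> coord_ge i k M = M.
Proof.
move=> hM kc; apply/seteqP; split=> [x [] //|x Mx]; split=> //.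
exact/val_ge_le/hM.
Qed.

Variables (L : set 'rV[K]_n) (mu : probability (borelType K n) R).
Hypothesis haar : is_normalized_haar L mu.

(** [M] is the disjoint union of the [q] translates of [M'] by the [t j], which have equal measure
    by invariance. *)
Lemma haar_coset_decomposition (M M' : set 'rV[K]_n) (t : 'I_q -> 'rV[K]_n) :
  measurable (M' : set (borelType K n)) ->
  (forall j, L (t j)) ->
  (forall i j y, M' (y - t i) -> M' (y - t j) -> i = j) ->
  (forall y, M y <-> exists j, M' (y - t j)) ->
  fine (mu M) = q%:R * fine (mu M').
Proof.
move=> mM' Lt t_inj Mt.
pose F j : set (borelType K n) := [set t j + y | y in M'].
have FE j y : F j y <-> M' (y - t j).
  split=> [[z hz <-]|h]; first by rewrite addrC addKr.
  by exists (y - t j) => //; rewrite addrC subrK.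
have -> : M = \big[setU/set0]_(j < q) F j.
  rewrite -bigcup_seq; apply/seteqP; split=> y.
    by move=> /Mt[j hj]; exists j; [exact: mem_index_enum|exact/FE].
  by move=> [j _ /FE hj]; apply/Mt; exists j.
rewrite measure_bigsetU_ord; last 2 first.
- by move=> j; exact: (measurable_translate hval).
- by move=> i j _ _ [y [/FE hi /FE hj]]; exact: t_inj hi hj.
rewrite (eq_bigr (fun=> mu M')) => [|j _]; last exact: haar.2.
rewrite -(fineK (fin_num_measure mu _ mM')) sumEFin /= sumr_const card_ord.
by rewrite mulr_natl.
Qed.

(* The cosets in the decomposition are represented by the multiples of [e] by
   representatives of the residue field. *)
Lemma haar_coord_geS (M : set 'rV[K]_n) (N k : int) (i : 'I_n) (e : 'rV[K]_n) :
  submodule M -> M `<=` L -> rball val N `<=` M -> M e ->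
  val (e ord0 i) = k%:E ->
  fine (mu (coord_ge i k M)) = q%:R * fine (mu (coord_ge i (k + 1) M)).
Proof.
move=> hM ML NM Me ek; have [c [c0 c_surj c_inj]] := residue_reps hval hq.
have Mc a : val_ge val 0 a -> M (a *: e) by move=> ha; exact: submoduleZ.
have e0 : e ord0 i != 0 by exact: val_neq0 ek.
(* Factoring out the [i]-th entry of [e], of valuation [k], turns level [k + 1] into a congruence
   modulo the maximal ideal. *)
have scale (y : 'rV[K]_n) j : (y - c j *: e) ord0 i =
    e ord0 i * (y ord0 i / e ord0 i - c j).
  by rewrite !mxE mulrBr mulrCA divff // mulr1 [c j * _]mulrC.
apply: (@haar_coset_decomposition _ _ (fun j => c j *: e)).
- apply: (@submodule_measurable _ (Num.max N (k + 1))).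
    exact: coord_ge_submodule.
  exact: coord_ge_rball.
- by move=> j; exact/ML/Mc.
- move=> j1 j2 y [_ h1] [_ h2]; apply: c_inj.
  move: h1 h2; rewrite !scale !(val_geMl hval _ _ ek) => h1 h2.
  have := val_geB hval h2 h1; congr (val_ge _ _ _); ring.
- move=> y; split=> [[My ky]|[j [My ky]]].
    have : val_ge val 0 (y ord0 i / e ord0 i).
      by rewrite -(val_geMl hval 0 _ ek) addr0 mulrC divfK.
    move=> /c_surj[j hj]; exists j; split; first by apply: submoduleB => //;
      exact: Mc.
    by rewrite scale (val_geMl hval _ _ ek).
  have kc : val_ge val k ((c j *: e) ord0 i).
    by rewrite mxE -[k]add0r val_geM // /val_ge ek.
  rewrite -(subrK (c j *: e) y); split; first by apply: submoduleD => //;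
    exact: Mc.
  rewrite mxE; apply: val_geD => //; apply: val_ge_le ky; lia.
Qed.

(** Iterates the previous step, the multiple of [e] by [pval hval d] attaining level [c + d]. For
    [k <= c] the slice is all of [M], whence the truncation at 0. *)
Lemma haar_coord_ge (M : set 'rV[K]_n) (N c : int) (i : 'I_n) (e : 'rV[K]_n) :
  submodule M -> M `<=` L -> rball val N `<=` M ->
  M e -> val (e ord0 i) = c%:E -> (forall x, M x -> val_ge val c (x ord0 i)) ->
  forall k, fine (mu (coord_ge i k M)) = q%:R ^- `|(Num.max 0 (k - c))%R|%N
    * fine (mu M).
Proof.
move=> hM ML NM Me ec cM k.
have [kc|ck] := leP k c.
  by rewrite (coord_ge_le cM kc) max_l ?subr_le0 // expr0 invr1 mul1r.
rewrite max_r ?subr_ge0 1?ltW //.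
have q0 : (q%:R : R) != 0.
  by rewrite pnatr_eq0; have := module_gt1 hval hq; lia.
have -> : k = c + `|(k - c)%R|%N by lia.
move: `|(k - c)%R|%N => d; rewrite addrAC subrr add0r absz_nat.
elim: d => [|d IH]; first by rewrite addr0 (coord_ge_le cM) // expr0 invr1
  mul1r.
have ed : val ((pval hval d *: e) ord0 i) = (c + d)%:E.
  by rewrite mxE (valuationM hval) ec (val_pval hval) -EFinD addrC.
have Med : M (pval hval d *: e) by apply: submoduleZ => //;
  rewrite (val_geE _ (val_pval hval d)).
have := haar_coord_geS hM ML NM Med ed; rewrite IH => E.
have -> : c + d.+1 = c + d + 1 by lia.
apply: (mulfI q0); rewrite -E exprS invfM mulrA mulrA mulfV // mul1r.
by [].
Qed.

End HaarTail.

(** * Tails of Haar measure on a planar lattice with a Hermite basis *)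

Lemma ord2P (i : 'I_2) : i = 0 \/ i = 1.
Proof. by case: i => [[|[|//]] ?]; [left|right]; exact/val_inj. Qed.

Section PlanarTail.
Variables (R : realType) (K : localFieldType) (val : K -> \bar int).
Hypothesis hval : is_normalized_valuation val.
Variable q : nat.
Hypothesis hq : is_module val q.

(* A Hermite basis of [L]. The number [m], which is [b] or the valuation of the
   second entry of [e], is the least valuation of a second entry in [L]. *)
Record adapted_basis (L : set 'rV[K]_2) (e f : 'rV[K]_2) (a m b : int) : Prop :=
  AdaptedBasis {
  adapted_e : L e ;
  adapted_f : L f ;
  adapted_e0 : val (e 0 0) = a%:E ;
  adapted_e1 : val_ge val m (e 0 1) ;
  adapted_f0 : f 0 0 = 0 ;
  adapted_f1 : val (f 0 1) = b%:E ;
  adapted_le : m <= b ;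
  adapted_lt : m < b -> val (e 0 1) = m%:E ;
  adapted_ge0 : forall x, L x -> val_ge val a (x 0 0) ;
  adapted_ge1 : forall x, L x -> x 0 0 = 0 -> val_ge val b (x 0 1)
}.

Variables (L : set 'rV[K]_2) (e f : 'rV[K]_2) (a m b : int).
Hypothesis hL : submodule val L.
Hypothesis hef : adapted_basis L e f a m b.

Lemma rV2P (x y : 'rV[K]_2) : x 0 0 = y 0 0 -> x 0 1 = y 0 1 -> x = y.
Proof.
move=> h0 h1; apply/rowP => i.
have [->|->] := ord2P i.
- exact: h0.
- exact: h1.
Qed.

Lemma adapted_rball : exists N, rball val N `<=` L.
Proof.
have e0 := val_neq0 hval (adapted_e0 hef);
  have f0 := val_neq0 hval (adapted_f1 hef).
(* [N >= a] makes [s] integral; [N >= b] and [N - a + m >= b] give the numerator of [t] valuation at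
   least [b], so [t] is integral. *)
pose N := Num.max (Num.max a b) (a + b - m); exists N => x hx.
pose s := x 0 0 / e 0 0; pose t := (x 0 1 - s * e 0 1) / f 0 1.
have hs : val_ge val (N - a) s.
  apply: (val_geM hval).
    exact: hx.
  by rewrite /val_ge (valuationV hval (adapted_e0 hef)).
have -> : x = s *: e + t *: f.
  apply: rV2P; rewrite !mxE ?(adapted_f0 hef) ?mulr0 ?addr0 divfK //.
  by rewrite addrC subrK.
apply: (submoduleD hL) => //; apply: (submoduleZ hL) => //.
- by apply: val_ge_le hs; lia.
- exact: adapted_e hef.
- rewrite -(subrr b); apply: (val_geM hval) => //.
    apply: (val_geB hval) => //; first by apply: val_ge_le (hx 1); lia.
    apply: val_ge_le (val_geM hval hs (adapted_e1 hef)); lia.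
  by rewrite /val_ge (valuationV hval (adapted_f1 hef)).
- exact: adapted_f hef.
Qed.

(** Subtracting the multiple [s *: e] that kills the first entry leaves a vector of [L] whose second
    entry has valuation at least [b], while [s] has valuation at least [max 0 (k - a)]. *)
Lemma adapted_snd_ge (k : int) x : coord_ge val 0 k L x ->
  val_ge val (Num.min (m + Num.max 0 (k - a)) b) (x 0 1).
Proof.
move=> [Lx kx]; have e0 := val_neq0 hval (adapted_e0 hef).
pose s := x 0 0 / e 0 0.
have hs : val_ge val (Num.max 0 (k - a)) s.
  have hx : val_ge val (Num.max a k) (x 0 0).
    by have [ak|ka] := leP a k => //; exact: (adapted_ge0 hef).
  have -> : Num.max 0 (k - a) = Num.max a k - a by lia.
  by apply: (val_geM hval) => //;
    rewrite /val_ge (valuationV hval (adapted_e0 hef)).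
have Ly : L (x - s *: e).
  apply: (submoduleB hval) => //; apply: (submoduleZ hL) (adapted_e hef) => //.
  by apply: val_ge_le hs; lia.
have y0 : (x - s *: e) 0 0 = 0 by rewrite !mxE divfK // subrr.
have := adapted_ge1 hef Ly y0.
have -> : x 0 1 = (x - s *: e) 0 1 + s * e 0 1 by rewrite !mxE subrK.
move=> h; apply: (val_geD hval) => //; first by apply: val_ge_le h; lia.
by apply: val_ge_le (val_geM hval hs (adapted_e1 hef)); lia.
Qed.

Lemma adapted_snd_attained (k : int) : exists2 x, coord_ge val 0 k L x &
  val (x 0 1) = (Num.min (m + Num.max 0 (k - a)) b)%:E.
Proof.
(* If the first term is the smaller one, then [m < b], so the second entry of [e] has valuation
   exactly [m] and a multiple of [e] works; otherwise [f] does. *)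
have [lt|ge] := ltP (m + Num.max 0 (k - a)) b.
  exists (pval hval (Num.max 0 (k - a)) *: e).
    split.
      apply: (submoduleZ hL) (adapted_e hef) => //.
      by rewrite (val_geE _ (val_pval hval _)); lia.
    by rewrite mxE /val_ge (valuationM hval) (val_pval hval) (adapted_e0 hef)
      lee_fin; lia.
  rewrite mxE (valuationM hval) (val_pval hval) (adapted_lt hef) -?EFinD;
    last by lia.
  by rewrite addrC.
exists f; last exact: adapted_f1 hef.
by split; [exact: adapted_f hef|rewrite (adapted_f0 hef) val_ge0].
Qed.

Variable mu : probability (borelType K 2) R.
Hypothesis haar : is_normalized_haar L mu.

(** [haar_coord_ge] is used twice: for the second coordinate on the slice at level [v1], with
    [c = min (m + d) b], then for the first coordinate on [L], with [c = a]. *)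
Lemma adapted_tail (v1 v2 : int) :
  let d := Num.max 0 (v1 - a) in
  fine (mu (coord_ge val 1 v2 (coord_ge val 0 v1 L))) =
  q%:R ^- `|(Num.max 0 (v2 - Num.min (m + d) b))%R|%N * q%:R ^- `|d|%N.
Proof.
move=> d; have [N NL] := adapted_rball.
have NM : rball val (Num.max N v1) `<=` coord_ge val 0 v1 L.
  exact: coord_ge_rball.
have [x Mx xv] := adapted_snd_attained v1.
rewrite (haar_coord_ge hval hq haar _ _ NM Mx xv) //; last 3 first.
- exact: coord_ge_submodule.
- by move=> y [].
- by move=> y /adapted_snd_ge.
rewrite (haar_coord_ge hval hq haar hL _ NL (adapted_e hef) (adapted_e0 hef))
  //.
  by rewrite haar.1 mulr1.
exact: adapted_ge0 hef.
Qed.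

(** Expanding the right-hand side gives the maximum of [0], [v1 - a], [v2 - m], [v2 - b] and
    [v1 + v2 - (a + b)]; since [m <= b], the term [v2 - b] is dominated. *)
Lemma cube_polynomialE (v : 'rV[int]_2) :
  let d := Num.max 0 (v 0 0 - a) in
  cube_polynomial 0%:~R a%:~R m%:~R (a + b)%:~R (map_mx intr v) =
  (d + Num.max 0 (v 0 1 - Num.min (m + d) b))%:~R :> R.
Proof.
have imax (x y : int) : Num.max (x%:~R : R) y%:~R = (Num.max x y)%:~R.
  by case: (leP x y) => h; [rewrite max_r|rewrite max_l] => //;
    rewrite ler_int // ltW.
rewrite /cube_polynomial !mxE -!(intrD, intrB) !imax.
congr (_%:~R); have := adapted_le hef; lia.
Qed.

End PlanarTail.

(** * Existence of a Hermite basis *)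

Section AdaptedBasisOfLattice.
Variables (K : localFieldType) (val : K -> \bar int).
Hypothesis hval : is_normalized_valuation val.

Lemma lattice_submodule n (L : set 'rV[K]_n) : is_lattice val L ->
  submodule val L.
Proof. by case=> _ L0 LD LZ; split. Qed.

(** The balls [rball val (- i)], for natural [i], form an increasing open cover of the space, so a
    finite subcover is contained in a single ball. *)
Lemma compact_bounded n (A : set 'rV[K]_n) :
  compact A -> exists N : int, A `<=` rball val N.
Proof.
move=> cA.
(* [K] has no canonical point, which the lemmas on compact sets ask for. *)
pose T : ptopologicalType :=
  HB.pack (K : Type) (isPointed.Build K (0 : K)) (Topological.class K).
have : @cover_compact 'rV[T]_n A by rewrite -compact_cover.
move=> /(_ nat setT (fun i : nat => rball val (- i%:Z))).
case.
- move=> i _; apply: (@rball_invariant_open _ _ hval _ (- i%:Z)) => x y hx hxy.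
  by rewrite -(subrK x y); exact: (rballD hval).
- move=> x _; have [k hk] := rball_bounded hval x.
  by exists `|k|%N => //; apply: rball_le hk; lia.
- move=> D _ AD; exists (- (\max_(i <- finmap.enum_fset D) i)%N%:Z) =>
    x /AD[i /= iD hx].
  apply: rball_le hx; rewrite lerN2 lez_nat.
  exact: (@leq_bigmax_seq _ _ xpredT id).
Qed.

(** Shifting by the lower bound [N] reduces this to the least element of a set of naturals, nonempty
    thanks to [x]. *)
Lemma val_min_attained (S : set K) (N : int) x :
  S x -> x != 0 -> (forall y, S y -> val_ge val N y) ->
  exists a : int, (exists2 y, S y & val y = a%:E) /\ forall y, S y ->
    val_ge val a y.
Proof.
move=> Sx x0 SN; pose P d := `[< exists2 y, S y & val y = (N + d%:Z)%:E >].
have exP : exists d, P d.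
  have [k kx] := val_fin hval x0; exists `|(k - N)%R|%N; apply/asboolP;
    exists x => //.
  by rewrite kx; have := SN _ Sx; rewrite (val_geE _ kx) => Nk; congr (_%:E);
    lia.
case: (ex_minnP exP) => d /asboolP hd dmin; exists (N + d); split=> // y Sy.
have [->|/(val_fin hval)[k ky]] := eqVneq y 0; first by rewrite val_ge0.
have := SN _ Sy; rewrite !(val_geE _ ky) => Nk.
have : P `|(k - N)%R|%N.
  by apply/asboolP; exists y => //; rewrite ky; congr (_%:E); lia.
by move=> /dmin; lia.
Qed.

Lemma det_mx22 (F : comNzRingType) (A : 'M[F]_2) :
  \det A = A 0 0 * A 1 1 - A 0 1 * A 1 0.
Proof.
rewrite (expand_det_row _ 0) !big_ord_recl big_ord0 /cofactor !det_mx11 !mxE /=.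
have -> : lift 0 0 = 1 :> 'I_2 by exact/val_inj.
have -> : lift 1 0 = 0 :> 'I_2 by exact/val_inj.
by rewrite !addn0 add0n expr0 expr1 mul1r addr0 mulN1r mulrN.
Qed.

Lemma full_rank_det (L : set 'rV[K]_2) : submodule val L -> full_rank L ->
  exists x y, [/\ L x, L y & x 0 0 * y 0 1 - x 0 1 * y 0 0 != 0].
Proof.
move=> hL [B LB]; rewrite row_free_unit unitmxE unitfE det_mx22 => detB.
by exists (row 0 B), (row 1 B); split=> //; rewrite !mxE.
Qed.

(** [e] minimizes the valuation of the first entry over [L], and [f] that of the second entry over
    the vectors of [L] with first entry 0. *)
Lemma lattice_adapted_basis (L : set 'rV[K]_2) : is_lattice val L ->
  full_rank L ->
  exists e f a m b, adapted_basis val L e f a m b.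
Proof.
move=> latL fullL; have hL := lattice_submodule latL.
have [N LN] := compact_bounded (lattice_compact latL).
have [x [y [Lx Ly det0]]] := full_rank_det hL fullL.
have [z Lz z0] : exists2 z, L z & z 0 0 != 0.
  have [x0|x0] := eqVneq (x 0 0) 0; last by exists x.
  exists y => //; apply: contraNneq det0 => y0.
  by rewrite x0 y0 mulr0 mul0r subrr.
have [|||a [[_ [e Le <-] ea] La]] :=
    @val_min_attained [set x 0 0 | x in L] N (z 0 0); [by exists z|done| |].
  by move=> _ [w Lw <-]; exact: LN.
pose S1 := [set x 0 1 | x in L `&` [set x : 'rV[K]_2 | x 0 0 = 0]].
(* [x 0 0 *: y - y 0 0 *: x] has first entry 0 and the nonzero determinant as second entry; the
   factor [c] makes its coefficients integral. *)
have [w Sw w0] : exists2 w, S1 w & w != 0.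
  have [k kx] := rball_bounded hval x; have [j jy] := rball_bounded hval y.
  pose c := pval hval (Num.max `|k|%:Z `|j|%:Z).
  have cO t i : val_ge val i t -> - i <= Num.max `|k|%:Z `|j|%:Z ->
    val_ge val 0 (c * t).
    move=> ti ij; apply: val_ge_le (val_geM hval (val_ge_pval hval _) ti); lia.
  exists (c * (x 0 0 * y 0 1 - x 0 1 * y 0 0));
    last by rewrite mulf_neq0 ?pval_neq0.
  exists ((c * x 0 0) *: y - (c * y 0 0) *: x); last by rewrite !mxE; ring.
  split; last by rewrite /= !mxE; ring.
  apply: (submoduleB hval) => //; apply: (submoduleZ hL) => //.
    by apply: cO (kx 0) _; lia.
  by apply: cO (jy 0) _; lia.
have [|b [[_ [f [Lf f0] <-] fb] Lb]] := val_min_attained (N := N) Sw w0.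
  by move=> _ [t [Lt _] <-]; exact: LN.
have La' t : L t -> val_ge val a (t 0 0) by move=> Lt; apply: La; exists t.
have Lb' t : L t -> t 0 0 = 0 -> val_ge val b (t 0 1).
  by move=> Lt t0; apply: Lb; exists t.
(* Either the second entry of [e] has valuation at least [b], and [m] is [b], or its valuation is
   some [m < b]. *)
have [be|nbe] := boolP (val_ge val b (e 0 1)).
  by exists e, f, a, b, b; split=> //; rewrite ltxx.
have e10 : e 0 1 != 0 by apply: contraNneq nbe => ->; rewrite val_ge0.
have [m em] := val_fin hval e10.
move: nbe; rewrite (val_geE _ em) -ltNge => mb.
by exists e, f, a, m, b; split=> //; rewrite ?(val_geE _ em) // ltW.
Qed.

End AdaptedBasisOfLattice.

(** * Compactness of balls and digit expansions of integer vectors *)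

Section IntegerVectors.
Variables (K : localFieldType) (val : K -> \bar int).
Hypothesis hval : is_normalized_valuation val.

Lemma compact_row n (A : 'I_n -> set K) : (forall i, compact (A i)) ->
  compact [set v : 'rV[K]_n | forall i, A i (v ord0 i)].
Proof.
pose T : ptopologicalType :=
  HB.pack (K : Type) (isPointed.Build K (0 : K)) (Topological.class K).
exact: (@rV_compact T n A).
Qed.

Lemma mulmx_rball n p (B : 'M[K]_(n, p)) : exists j : int,
  forall k (x : 'rV[K]_n),
  rball val k x -> rball val (j + k) (x *m B).
Proof.
have h (i : 'I_n * 'I_p) : exists k, val_ge val k (B i.1 i.2).
  have [->|/(val_fin hval)[k E]] := eqVneq (B i.1 i.2) 0.
    by exists 0; rewrite val_ge0.
  by exists k; rewrite (val_geE _ E).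
have [k hk] := choice h.
exists (\big[Num.min/0]_i k i) => l x hx i; rewrite mxE.
apply: (big_ind (val_ge val _)) => [|y z|j _]; first exact: val_ge0.
  exact: (val_geD hval).
rewrite mulrC; apply: (val_geM hval) => //.
by apply: val_ge_le (hk (j, i)); exact: bigmin_le.
Qed.

Lemma mulmx_continuous n p (B : 'M[K]_(n, p)) :
  continuous (fun x : 'rV[K]_n => x *m B).
Proof.
move=> x U /(nbhs_rowP hval)[k hk]; have [j hj] := mulmx_rball B.
apply/(nbhs_rowP hval); exists (k - j) => y hy; apply: hk.
by rewrite -mulmxBl -[k](subrKC j); exact: hj.
Qed.

Lemma compact_mulmx n p (B : 'M[K]_(n, p)) (A : set 'rV[K]_n) :
  compact A -> compact [set x *m B | x in A].
Proof.
move=> cA; apply: continuous_compact => //.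
exact/continuous_subspaceT/mulmx_continuous.
Qed.

(** Local compactness gives a compact neighbourhood of 0, which contains a ball of [K]; that ball is
    closed, hence compact. Products and scaling reach every [n] and [k]. *)
Lemma rball_compact n (k : int) : compact (rball val k : set 'rV[K]_n).
Proof.
have [U nU [cU _]] := local_field_locally_compact (0 : K) I.
have {nU} : nbhs (0 : K) U by rewrite withinET in nU.
move=> /(nbhs_valP hval)[j jU].
have cj : compact [set x | val_ge val j x].
  apply: subclosed_compact cU _; last by move=> x hx; apply: jU; rewrite subr0.
  rewrite -[X in closed X]setCK; apply: open_closedC; rewrite openE => x /= nx.
  apply/(nbhs_valP hval); exists j => y hxy hy; apply: nx.
  by have := val_geB hval hy hxy; rewrite subKr.
have := @compact_mulmx _ _ ((pval hval (k - j))%:M : 'M[K]_n) _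
  (compact_row (fun=> cj)).
congr compact; apply/seteqP; split=> [_ [x hx <-]|x hx].
  have := rballZ hval (val_ge_pval hval (k - j)) hx.
  by rewrite subrK mul_mx_scalar.
exists ((pval hval (k - j))^-1 *: x); last first.
  by rewrite mul_mx_scalar scalerA divff ?scale1r // pval_neq0.
move=> i; rewrite mxE.
have hV : val_ge val (- (k - j)) (pval hval (k - j))^-1.
  by rewrite /val_ge (valuationV hval (val_pval hval _)).
by have := val_geM hval hV (hx i); rewrite opprB subrK.
Qed.

(** Compactness provides a cluster point [x]. From index [k] on, the sequence stays in the coset of
    [u k] modulo [rball val k], so [x] lies in it too. *)
Lemma rball_complete n (u : nat -> 'rV[K]_n) :
  (forall k, rball val 0 (u k)) ->
  (forall k : nat, rball val k (u k.+1 - u k)) ->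
  exists x, forall k : nat, rball val k (x - u k).
Proof.
move=> u0 uS.
have uD (k d : nat) : rball val k (u (k + d)%N - u k).
  elim: d => [|d IH]; first by rewrite addn0 subrr; exact: (rball0 hval).
  apply: (rball_trans hval) IH; rewrite addnS.
  by apply: rball_le (uS _); lia.
have uO : (u @ \oo) (rball val 0 : set 'rV[K]_n) by exists 0%N => // k _;
  exact: u0.
have [x [_ xu]] := @rball_compact n 0 (u @ \oo) _ uO.
exists x => k.
have [||y [[i /= ki <-] hi]] :=
  xu [set u i | i in [set i | (k <= i)%N]] [set y | rball val k (y - x)].
- by exists k => // i /= ki; exists i.
- by apply/(nbhs_rowP hval); exists k%:Z.
apply: (rball_trans hval) (rballC hval hi) _.
by rewrite -(subnKC ki).
Qed.

Variables (q : nat).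
Hypothesis hq : is_module val q.

(** Representatives are chosen coordinatewise. They are indexed by naturals so that remainders
    modulo [Q] serve as digits; the default [t0] keeps [c d] integral for every [d]. *)
Lemma residue_row_reps n : exists (Q : nat) (c : nat -> 'rV[K]_n),
  [/\ (0 < Q)%N,
      forall d, rball val 0 (c d),
      forall x, rball val 0 x -> exists2 d, (d < Q)%N & rball val 1 (x - c d) &
      forall d d', (d < Q)%N -> (d' < Q)%N -> rball val 1 (c d - c d') ->
        d = d'].
Proof.
have [c [c0 c_surj c_inj]] := residue_reps hval hq.
pose T := {ffun 'I_n -> 'I_q}; pose r (t : T) : 'rV[K]_n := \row_i c (t i).
have q0 : (0 < q)%N by apply: ltnW (module_gt1 hval hq).
pose t0 : T := [ffun=> Ordinal q0].
have T0 : (0 < #|T|)%N by apply/card_gt0P; exists t0.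
exists #|T|, (fun d => r (nth t0 (enum T) d)); split=> //.
- by move=> d i; rewrite mxE.
- move=> x hx; have [t ht] := choice (fun i => c_surj _ (hx i)).
  exists (index (finfun t) (enum T)); first by rewrite cardE index_mem mem_enum.
  by move=> i; rewrite nth_index ?mem_enum // !mxE ffunE.
- move=> d d'; rewrite cardE => dT d'T h.
  apply/eqP; rewrite -(nth_uniq t0 dT d'T (enum_uniq _)); apply/eqP.
  by apply/ffunP => i; apply: c_inj; have := h i; rewrite !mxE.
Qed.

Section Digits.
Variables (n Q : nat) (c : nat -> 'rV[K]_n).
Hypotheses (Q0 : (0 < Q)%N) (c0 : forall d, rball val 0 (c d)).
Hypothesis c_surj :
  forall x, rball val 0 x -> exists2 d, (d < Q)%N & rball val 1 (x - c d).
Hypothesis c_inj : forall d d', (d < Q)%N -> (d' < Q)%N ->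
  rball val 1 (c d - c d') -> d = d'.

(* The vector with base-[Q] expansion [j], the most significant digit of [j]
   being the residue modulo the maximal ideal. *)
Fixpoint digit_sum (k j : nat) : 'rV[K]_n :=
  if k is k'.+1 then digit_sum k' (j %/ Q) + pval hval k'%:Z *: c (j %% Q)
    else 0.

Lemma digit_rball (k d : nat) : rball val k (pval hval k *: c d).
Proof. by have := rballZ hval (val_ge_pval hval k) (c0 d); rewrite addr0. Qed.

Lemma digit_sumS (k j : nat) :
  rball val k (digit_sum k.+1 j - digit_sum k (j %/ Q)).
Proof. by rewrite /= addrC addKr; exact: digit_rball. Qed.

Lemma digit_sum0 (k j : nat) : rball val 0 (digit_sum k j).
Proof.
elim: k j => [|k IH] j /=; first exact: (rball0 hval).
by apply: (rballD hval) => //; apply: rball_le (digit_rball _ _); lia.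
Qed.

(** By induction on [k]: once [j0] approximates [y] to level [k], the error divided by [pval hval k]
    is an integral [w], and the residue of [w] is the one digit [d] that can be appended to [j0]. *)
Lemma digit_sum_bij (k : nat) y : rball val 0 y -> exists2 j0, (j0 < Q ^ k)%N &
  forall j, (j < Q ^ k)%N -> rball val k (digit_sum k j - y) <-> j = j0.
Proof.
move=> y0; elim: k => [|k [j0 j0Q IH]].
  exists 0%N; first by rewrite expn0.
  move=> j; rewrite expn0 ltnS leqn0 => /eqP ->; split=> // _.
  by rewrite sub0r; exact: (rballN hval).
have z0 : rball val k (y - digit_sum k j0) by apply: (rballC hval); exact/IH.
pose w := (pval hval k)^-1 *: (y - digit_sum k j0).
have yE : y = digit_sum k j0 + pval hval k *: w.
  by rewrite scalerA divff ?pval_neq0 // scale1r addrC subrK.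
have w0 : rball val 0 w.
  by apply/(rballZl hval 0 w (val_pval hval k));
    rewrite addr0 scalerA divff ?pval_neq0 ?scale1r.
have [d dQ wd] := c_surj w0.
exists (j0 * Q + d)%N => [|j jQ].
  by rewrite expnSr; apply: (@leq_trans (j0.+1 * Q));
    [lia|rewrite leq_mul2r j0Q orbT].
have jk : (j %/ Q < Q ^ k)%N by rewrite ltn_divLR // -expnSr.
have jd : (j %% Q < Q)%N by rewrite ltn_mod.
split=> [h|->].
  have e0 : (j %/ Q)%N = j0.
    apply/IH => //; have h' : rball val k (digit_sum k.+1 j - y)
      by apply: rball_le h; lia.
    exact: (rball_trans hval) (rballC hval (digit_sumS k j)) h'.
  have e1 : (j %% Q)%N = d.
    apply: c_inj => //; apply: (rball_trans hval) wd.
    apply/(rballZl hval 1 _ (val_pval hval k)).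
    move: h; rewrite /= e0 {1}yE opprD addrACA subrr add0r -scalerBr.
    by apply: rball_le; lia.
  by rewrite {1}(divn_eq j Q) e0 e1.
rewrite /= divnMDl // divn_small // addn0 modnMDl modn_small //.
rewrite {1}yE opprD addrACA subrr add0r -scalerBr.
have -> : k.+1%:Z = k%:Z + 1 by lia.
by apply/(rballZl hval 1 _ (val_pval hval k))/(rballC hval).
Qed.

(** Translation by [x] acts injectively on the classes modulo [rball val k], hence on their indices.
    An inequality is enough, since it will also be used with [- x]. *)
Lemma digit_sum_translate (k : nat) (x : 'rV[K]_n) (T : set 'rV[K]_n) :
  rball val 0 x ->
  (forall y z, T y -> rball val k (z - y) -> T z) ->
  (#|[pred j : 'I_(Q ^ k) | `[< T (digit_sum k j) >]]| <=
   #|[pred j : 'I_(Q ^ k) | `[< T (digit_sum k j - x)%R >]]|)%N.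
Proof.
move=> x0 hT.
have h (j : 'I_(Q ^ k)) : exists i : 'I_(Q ^ k),
    rball val k (digit_sum k i - (digit_sum k j + x)).
  have yO : rball val 0 (digit_sum k j + x).
    by apply: (rballD hval) => //; exact: digit_sum0.
  by have [i iQ /(_ i iQ) hi] := digit_sum_bij k yO; exists (Ordinal iQ);
    exact/hi.
have [s hs] := choice h.
have s_inj : injective s.
  move=> i j sij; have [l lQ hl] := digit_sum_bij k (digit_sum0 k j).
  apply/val_inj => /=; transitivity l.
    apply/hl => //.
    have := rballC hval (hs i); rewrite sij => /(rball_trans hval)/(_ (hs j)).
    by rewrite opprD addrACA subrr addr0.
  by apply/esym/hl => //; rewrite subrr; exact: (rball0 hval).
rewrite -(card_imset _ s_inj); apply: subset_leq_card.
apply/fintype.subsetP => _ /imsetP[j + ->].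
rewrite !inE => Tj; apply: (hT _ _ Tj).
by rewrite -addrA -opprD [x + _]addrC.
Qed.

End Digits.
End IntegerVectors.

(** * Equidistribution of the digits of a uniform point of [[0, 1[] *)

Section UniformDigits.
Variable R : realType.

Definition unif01 : set (measurableTypeR R) -> \bar R :=
  mrestr (@lebesgue_measure R) (measurable_itv `[0, 1[).

HB.instance Definition _ := Measure.on unif01.

Lemma unif01_setT : unif01 setT = 1%E.
Proof.
by rewrite /unif01 /mrestr setTI lebesgue_measure_itv /= lte01 oppr0 adde0.
Qed.

HB.instance Definition _ :=
  Measure_isProbability.Build _ _ _ unif01 unif01_setT.

Variable N : nat.
Hypothesis N0 : (0 < N)%N.
Let N0R : 0 < N%:R :> R. Proof. by rewrite ltr0n. Qed.

Lemma measurable_truncn_mul (S : set nat) :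
  measurable [set w : measurableTypeR R | S (Num.truncn (N%:R * w))].
Proof.
have -> : [set w : measurableTypeR R | S (Num.truncn (N%:R * w))] =
    \bigcup_(j in S) [set w | Num.truncn (N%:R * w) = j].
  by apply/seteqP; split=> [w Sw|w [j Sj /= ->]];
    [exists (Num.truncn (N%:R * w))|].
apply: bigcup_measurable => -[|j] _.
  (* [Num.truncn] vanishes on negative reals, so the fibre over 0 is a half-line and is treated
     apart. *)
  have -> : [set w : R | Num.truncn (N%:R * w) = 0%N] = `]-oo, N%:R^-1[%classic.
    apply/seteqP; split=> w /=; rewrite in_itv /=.
      by move=> /eqP; rewrite -leqn0 truncn_le_nat mulrC -ltr_pdivlMr // mul1r.
    by rewrite -[X in _ < X]mul1r ltr_pdivlMr // mulrC => h; apply/eqP;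
      rewrite -leqn0 truncn_le_nat.
  exact: measurable_itv.
have -> : [set w : R | Num.truncn (N%:R * w) = j.+1] =
    `[j.+1%:R / N%:R, j.+2%:R / N%:R[%classic.
  apply/seteqP; split=> w /=; rewrite in_itv /= ler_pdivrMr // ltr_pdivlMr //
    [w * _]mulrC.
    by move=> wj; rewrite -truncn_gt_nat -truncn_le_nat wj !leqnn.
  exact: truncn_def.
exact: measurable_itv.
Qed.

(** Within [[0, 1[] the fibres of the truncation are [N] intervals of length [1 / N]. *)
Lemma unif01_truncn (S : set nat) :
  unif01 [set w | S (Num.truncn (N%:R * w))] =
  (#|[pred j : 'I_N | `[< S j >]]|%:R / N%:R)%:E.
Proof.
pose F (j : nat) : set (measurableTypeR R) :=
  `[j%:R / N%:R, j.+1%:R / N%:R[%classic.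
have FE j w : F j w <-> (0 <= w /\ Num.truncn (N%:R * w) = j).
  rewrite /F /= in_itv /= ler_pdivrMr // ltr_pdivlMr // [w * _]mulrC; split.
    move=> h; split; last exact: truncn_def.
    by move/andP : h => [h _]; rewrite -(pmulr_rge0 _ N0R); apply: le_trans h.
  by move=> [w0 <-]; apply: truncn_itv; rewrite mulr_ge0 // ltW.
rewrite /unif01 /mrestr.
have -> : [set w : R | S (Num.truncn (N%:R * w))] `&` `[0, 1[ =
    \big[setU/set0]_(j < N | `[< S j >]) F j.
  rewrite -bigcup_seq_cond; apply/seteqP; split=> w /=.
    rewrite in_itv /= => -[Sw /andP[w0 w1]].
    have Nw0 : 0 <= N%:R * w by rewrite mulr_ge0 // ltW.
    have wN : (Num.truncn (N%:R * w) < N)%N by rewrite truncn_lt_nat // gtr_pMr.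
    exists (Ordinal wN); last exact/FE.
    by rewrite /= mem_index_enum; apply/asboolP.
  move=> [j /= /andP[_ /asboolP Sj] /FE[w0 wj]]; rewrite wj; split=> //.
  have Nw0 : 0 <= N%:R * w by rewrite mulr_ge0 // ltW.
  by rewrite in_itv /= w0 -(ltr_pM2l N0R) mulr1 -truncn_lt_nat // wj ltn_ord.
rewrite measure_bigsetU_ord; last 2 first.
- by move=> j; exact: measurable_itv.
- by move=> i j _ _ [w [/FE[_ wi] /FE[_ wj]]]; apply/val_inj; rewrite /= -wi.
rewrite (eq_bigr (fun=> (N%:R^-1)%:E)) => [|j _]; last first.
  rewrite /F /= lebesgue_measure_itv /= lte_fin ltr_pM2r ?invr_gt0 // ltr_nat
    ltnSn.
  by rewrite -EFinD -mulrBl -natrB // subSnn mul1r.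
by rewrite sumEFin sumr_const mulr_natl.
Qed.

End UniformDigits.

(** * A random integer vector with translation-invariant law *)

Section HaarExistence.
Variables (R : realType) (K : localFieldType) (val : K -> \bar int).
Hypothesis hval : is_normalized_valuation val.
Variable n : nat.

(** The union of the cosets of [rball val k] contained in [U]. *)
Definition rball_interior (k : nat) (U : set 'rV[K]_n) : set 'rV[K]_n :=
  [set y | forall z, rball val k (z - y) -> U z].

Lemma rball_interior_invariant (k : nat) (U : set 'rV[K]_n) y z :
  rball_interior k U y -> rball val k (z - y) -> rball_interior k U z.
Proof. by move=> hy hz t ht; apply: hy; exact: (rball_trans hval) ht hz. Qed.

Lemma rball_interior_nondecreasing (U : set 'rV[K]_n) :
  nondecreasing_seq (fun k => rball_interior k U).
Proof.
move=> j k jk; apply/subsetPset => y hy z hz; apply: hy.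
by apply: rball_le hz; lia.
Qed.

Lemma bigcup_rball_interior (U : set 'rV[K]_n) : open U ->
  \bigcup_k rball_interior k U = U.
Proof.
move=> oU; apply/seteqP; split=> [y [k _ hy]|y Uy].
  by apply: hy; rewrite subrr; exact: (rball0 hval).
by have [k hk] := (open_rowP hval _).1 oU _ Uy; exists k.
Qed.

(** Open sets generate the Borel sets and are stable under intersection. Each is the increasing
    union of its sets [rball_interior k U], so continuity from below gives equality on it. *)
Lemma invariant_measure_eq (mu nu : probability (borelType K n) R) :
  (forall (k : nat) (T : set 'rV[K]_n),
     (forall y z, T y -> rball val k (z - y) -> T z) -> mu T = nu T) ->
  forall A, measurable A -> mu A = nu A.
Proof.
move=> inv; apply: (@measure_unique _ R (borelType K n) (@borel_rV K n)
  (fun=> setT) _ _ _ _ mu nu) => //.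
- by move=> A B oA oB; exact: openI.
- by move=> _; exact: openT.
- by rewrite bigcup_const.
- move=> U oU.
  have mU k : measurable (rball_interior k U : set (borelType K n)).
    apply: (@rball_invariant_measurable _ _ hval _ k) => y z.
    exact: rball_interior_invariant.
  have mbU : measurable (\bigcup_k rball_interior k U : set (borelType K n)).
    exact: bigcup_measurable.
  have ndU := @rball_interior_nondecreasing U.
  have := @nondecreasing_cvg_mu _ _ _ mu _ mU mbU ndU.
  have := @nondecreasing_cvg_mu _ _ _ nu _ mU mbU ndU.
  rewrite bigcup_rball_interior //.
  have -> : mu \o (fun k => rball_interior k U) =
      nu \o (fun k => rball_interior k U).
    apply/funext => k /=; apply: (inv k) => y z;
      exact: rball_interior_invariant.
  move=> h1 h2; exact: cvg_unique h2 h1.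
- by move=> k; exact: fin_num_fun_lty.
Qed.

Variables (q : nat).
Hypothesis hq : is_module val q.

(** [j k w] collects the first [k] digits of [w] in base [Q], and [X w] is the limit of the
    corresponding digit sums. On sets invariant under [rball val k] the law of [X] is a normalized
    count over [Q ^ k] indices. *)
Lemma exists_integer_haar : exists X : {RV (@unif01 R) >-> borelType K n},
  is_normalized_haar (rball val 0) (distribution (@unif01 R) X).
Proof.
have [Q [c [Q0 c0 c_surj c_inj]]] := residue_row_reps hval hq n.
have Qk0 k : (0 < Q ^ k)%N by rewrite expn_gt0 Q0.
pose s := digit_sum hval Q c.
pose j (k : nat) (w : R) := Num.truncn ((Q ^ k)%N%:R * w).
(* Deleting the last digit; for negative [w] both truncations are 0. *)
have jS k w : (j k.+1 w %/ Q)%N = j k w.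
  have [w0|w0] := leP 0 w; last first.
    have j0 i : j i w = 0%N.
      by apply/eqP; rewrite -leqn0 truncn_le_nat; apply: le_lt_trans ltr01;
        rewrite pmulr_rle0 ?ltr0n // ltW.
    by rewrite !j0 div0n.
  apply/esym/truncn_def.
  have /truncn_itv : 0 <= (Q ^ k.+1)%N%:R * w by rewrite mulr_ge0.
  rewrite -/(j k.+1 w) expnSr => /andP[h1 h2].
  have QR : 0 < Q%:R :> R by rewrite ltr0n.
  rewrite -(ler_pM2r QR) -(ltr_pM2r QR) mulrAC -!natrM.
  apply/andP; split; first by apply: le_trans h1; rewrite ler_nat leq_divM.
  by apply: lt_le_trans h2 _; rewrite ler_nat ltn_ceil.
have exX (w : R) : exists x, forall k : nat, rball val k (x - s k (j k w)).
  apply: (rball_complete hval) => k; first exact: digit_sum0.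
  by rewrite -(jS k w); exact: digit_sumS.
have [X hX] := choice exX.
have X0 w : rball val 0 (X w) by have := hX w 0%N; rewrite /s /= subr0.
(* An event at level [k] depends on the first [k] digits only. *)
have XT (k : nat) (T : set 'rV[K]_n) :
    (forall y z, T y -> rball val k (z - y) -> T z) ->
    X @^-1` T = [set w | T (s k (j k w))].
  move=> hT; apply/seteqP; split=> w /= hw; apply: hT hw _; last exact: hX.
  exact/(rballC hval)/hX.
have mX : measurable_fun [set: measurableTypeR R] (X : _ -> borelType K n).
  apply: measurable_fun_row => U oU;
    rewrite -(bigcup_rball_interior oU) preimage_bigcup.
  apply: bigcup_measurable => k _.
  rewrite (XT k) => [|y z]; last exact: rball_interior_invariant.
  exact: (measurable_truncn_mul (Qk0 k) (fun i => rball_interior k U (s k i))).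
pose Y : {RV (@unif01 R) >-> borelType K n} := mfun_Sub (mem_set mX).
have muT (k : nat) (T : set 'rV[K]_n) :
    (forall y z, T y -> rball val k (z - y) -> T z) ->
    distribution (@unif01 R) Y T =
    (#|[pred i : 'I_(Q ^ k) | `[< T (s k i) >]]|%:R / (Q ^ k)%N%:R)%:E.
  move=> hT; rewrite -(unif01_truncn R (Qk0 k) (fun i => T (s k i))).
  by rewrite -XT.
have le_mu (x : 'rV[K]_n) (k : nat) (T : set 'rV[K]_n) : rball val 0 x ->
    (forall y z, T y -> rball val k (z - y) -> T z) ->
    (distribution (@unif01 R) Y T <=
     distribution (@unif01 R) Y [set y : 'rV[K]_n | T (y - x)%R])%E.
  move=> x0 hT; rewrite (muT k T hT) (muT k) => [|y z hy hz].
    rewrite lee_fin ler_pM2r ?invr_gt0 ?ltr0n // ler_nat.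
    exact: (digit_sum_translate hval Q0 c0 c_surj c_inj x0 hT).
  by apply: hT hy _; rewrite opprB addrA subrK.
exists Y; split.
  rewrite -(probability_setT (distribution (@unif01 R) Y)) /distribution
    /pushforward.
  by congr unif01; apply/seteqP; split=> w // _; exact: X0.
move=> x A x0 mA.
have mXx : measurable_fun [set: measurableTypeR R]
    ((fun w => X w - x) : _ -> borelType K n).
  exact: (measurableT_comp (measurable_subr hval x) mX).
pose Z : {RV (@unif01 R) >-> borelType K n} := mfun_Sub (mem_set mXx).
(* The measure of [x + A] is the probability that [X - x] lies in [A], so invariance says that
   [X - x] and [X] have the same law. *)
transitivity (distribution (@unif01 R) Z A).
  congr unif01; apply/seteqP; split=> w /=.
    by move=> [y Ay /= <-]; rewrite addrC addKr.
  by exists (X w - x) => //; rewrite addrC subrK.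
(* One inequality is [le_mu] for [T] and [x], the other is [le_mu] for the translate of [T] and
   [- x]. *)
apply: invariant_measure_eq mA => k T hT; apply/eqP; rewrite eq_le;
  apply/andP; split.
  have hTx (y z : 'rV[K]_n) : T (y - x) -> rball val k (z - y) -> T (z - x).
    by move=> hy hz; apply: hT hy _; rewrite opprB addrA subrK.
  have := le_mu (- x) k [set y : 'rV[K]_n | T (y - x)] (rballN hval x0) hTx.
  have -> : [set y : 'rV[K]_n | [set y : 'rV[K]_n | T (y - x)] (y - - x)] = T.
    by apply/seteqP; split=> y /=; rewrite opprK addrK.
  by [].
exact: (le_mu x k T).
Qed.

End HaarExistence.

(** * Linear images of Haar measure, tails of Gaussian vectors, and the equivalence *)

Section GaussianTails.
Variables (R : realType) (K : localFieldType) (val : K -> \bar int).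
Hypothesis hval : is_normalized_valuation val.
Variable q : nat.
Hypothesis hq : is_module val q.

(** Under [B], translation by [x *m B] pulls back to translation by [x], which preserves the law of
    [X]. *)
Lemma haar_mulmx n (B : 'M[K]_n) (L : set 'rV[K]_n) d (Omega : measurableType d)
    (P : probability Omega R) (X : {RV P >-> borelType K n}) :
  B \in unitmx -> is_normalized_haar L (distribution P X) ->
  exists Y : {RV P >-> borelType K n},
    is_normalized_haar [set x *m B | x in L] (distribution P Y).
Proof.
move=> uB haar; pose g (x : borelType K n) : borelType K n :=
  (x : 'rV[K]_n) *m B.
have mg : measurable_fun [set: borelType K n] g.
  apply: measurable_fun_row => U oU; apply: open_measurable_row.
  by apply: open_comp oU => x _; exact: (mulmx_continuous hval).
have g_inj (x y : 'rV[K]_n) : x *m B = y *m B -> x = y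
  by exact: (can_inj (mulmxK uB)).
have mY : measurable_fun [set: Omega] (g \o X) by exact: measurableT_comp.
exists (mfun_Sub (mem_set mY)); split.
  rewrite -haar.1 /distribution /pushforward; congr (P _).
  apply/seteqP; split=> w /= => [[x Lx /g_inj <-] //|LX].
  by exists (X w).
move=> _ A [x Lx <-] mA.
have mgA : measurable (g @^-1` A) by rewrite -[_ @^-1` _]setTI; exact: mg.
apply: etrans (haar.2 x _ Lx mgA); rewrite /distribution /pushforward;
  congr (P _).
apply/seteqP; split=> w /=.
  move=> [y Ay hy]; exists ((X w : 'rV[K]_n) - x); last by rewrite addrC subrK.
  by rewrite /g mulmxBl -[_ *m B]hy addrC addKr.
by move=> [y Ay <-]; exists (g y) => //; rewrite /g mulmxDl.
Qed.

Lemma neg_log_tail_adapted (L : set 'rV[K]_2) d (Omega : measurableType d)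
    (P : probability Omega R) (X : {RV P >-> borelType K 2})
    (e f : 'rV[K]_2) (a m b : int) (v : 'rV[int]_2) :
  gaussian_with_lattice val X L -> adapted_basis val L e f a m b ->
  neg_log_tail val X q v =
  cube_polynomial 0%:~R a%:~R m%:~R (a + b)%:~R (map_mx intr v).
Proof.
move=> [latL haar] hef; have hL := lattice_submodule latL.
have [N NL] := adapted_rball hval hL hef.
have mL := submodule_measurable hval hL NL.
rewrite (cube_polynomialE R hef) /neg_log_tail.
set d0 := Num.max 0 (v 0 0 - a); set d1 := Num.max 0 (v 0 1 - _).
pose T := coord_ge val 0 (v 0 0) (coord_ge val 1 (v 0 1) [set: 'rV[K]_2]).
have TE (w : Omega) : ge_vec (val_vec val (X w)) v <-> T (X w).
  split=> [h|[[_ h1] h0] i].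
    by split; [split=> //; have := h 1|have := h 0]; rewrite mxE.
  rewrite mxE; have [->|->] := ord2P i; first exact: h0.
  exact: h1.
have mT : measurable (T : set (borelType K 2)).
  apply: (@rball_invariant_measurable _ _ hval _ (Num.max (v 0 0) (v 0 1))).
  move=> x y [[_ h1] h0] hxy; rewrite -(subrK x y); split; first split=> //.
    by rewrite mxE (val_geD hval) //; apply: val_ge_le (hxy 1);
      rewrite le_max lexx orbT.
  by rewrite mxE (val_geD hval) //; apply: val_ge_le (hxy 0);
    rewrite le_max lexx.
have -> : P [set w | ge_vec (val_vec val (X w)) v] = distribution P X T.
  by congr (P _); apply/seteqP; split=> w /TE.
(* [L] has full measure, so the tail event may be intersected with [L], where [adapted_tail]
   applies. *)
have -> : distribution P X T =
    distribution P X (coord_ge val 1 (v 0 1) (coord_ge val 0 (v 0 0) L)).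
  have -> : coord_ge val 1 (v 0 1) (coord_ge val 0 (v 0 0) L) = T `&` L.
    by apply/seteqP; split=> x => [[[? ?] ?]|[[[? ?] ?] ?]].
  have LC0 : distribution P X (~` L) = 0%E.
    by rewrite probability_setC // haar.1 subee.
  have TL0 : distribution P X (T `\` L) = 0%E.
    apply: subset_measure0 LC0; [exact: measurableD|exact: measurableC|].
    exact: subDsetr.
  by rewrite (measureDI _ mT mL) [X in (X + _)%E](TL0 : _ = 0%E) add0e.
rewrite (adapted_tail hval hq hL hef haar) -/d0 -/d1 /logb.
have q1 : 1 < q%:R :> R by rewrite ltr1n (module_gt1 hval hq).
rewrite -invfM -exprD lnV ?lnXn; last 2 first.
- by rewrite (lt_trans ltr01).
- by rewrite posrE exprn_gt0 // (lt_trans ltr01).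
rewrite mulNr opprK -[ln _ *+ _]mulr_natl mulfK;
  last by rewrite gt_eqF // ln_gt0.
have d0_ge0 : 0 <= d0 by rewrite le_max lexx.
have d1_ge0 : 0 <= d1 by rewrite le_max lexx.
by rewrite pmulrn; congr (_%:~R); lia.
Qed.

(** The rows are the vectors [e] and [f] of a Hermite basis; they span the image of the integer row
    vectors. *)
Definition adapted_mx (a m b : int) : 'M[K]_2 :=
  \matrix_(i, j) if i == 0 then if j == 0 then pval hval a else pval hval m
                 else if j == 0 then 0 else pval hval b.

Lemma adapted_mxE a m b (x : 'rV[K]_2) :
  ((x *m adapted_mx a m b) 0 0 = x 0 0 * pval hval a) *
  ((x *m adapted_mx a m b) 0 1 = x 0 0 * pval hval m + x 0 1 * pval hval b).
Proof.
have l1 : lift 0 0 = 1 :> 'I_2 by exact/val_inj.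
split; rewrite !mxE !big_ord_recl big_ord0 /= !mxE /= l1 /= ?mulr0 ?addr0 //.
Qed.

Lemma adapted_mx_unit a m b : adapted_mx a m b \in unitmx.
Proof.
rewrite unitmxE det_mx22 !mxE /= mulr0 subr0 unitfE.
by rewrite mulf_neq0 // pval_neq0.
Qed.

Lemma mulmx_lattice n (B : 'M[K]_n) : B \in unitmx ->
  is_lattice val [set x *m B | x in rball val 0] /\
  full_rank [set x *m B | x in rball val 0].
Proof.
move=> uB; split.
  split.
  - exact/(compact_mulmx hval)/(rball_compact hval).
  - by exists 0; [exact: (rball0 hval)|rewrite mul0mx].
  - move=> _ _ [x hx <-] [y hy <-]; exists (x + y); first exact: (rballD hval).
    by rewrite mulmxDl.
  - move=> c _ hc [x hx <-]; exists (c *: x); last by rewrite scalemxAl.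
    by rewrite -[0]add0r; exact: (rballZ hval).
exists B; last by rewrite row_free_unit.
move=> i; exists (delta_mx 0 i); last by rewrite -rowE.
move=> j; rewrite mxE; case: (_ && _); last exact: val_ge0.
by rewrite /val_ge (valuation1 hval).
Qed.

Lemma adapted_mx_basis a m b : m <= b ->
  adapted_basis val [set x *m adapted_mx a m b | x in rball val 0]
    (delta_mx 0 0 *m adapted_mx a m b) (delta_mx 0 1 *m adapted_mx a m b) a m b.
Proof.
move=> mb; have d_rball (i : 'I_2) : rball val 0 (delta_mx 0 i : 'rV[K]_2).
  move=> j; rewrite mxE; case: (_ && _); last exact: val_ge0.
  by rewrite /val_ge (valuation1 hval).
split.
- by exists (delta_mx 0 0).
- by exists (delta_mx 0 1).
- by rewrite adapted_mxE !mxE mul1r val_pval.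
- by rewrite adapted_mxE !mxE /= mul1r mul0r addr0 val_ge_pval.
- by rewrite adapted_mxE !mxE /= mul0r.
- by rewrite adapted_mxE !mxE /= mul1r mul0r add0r val_pval.
- exact: mb.
- by rewrite adapted_mxE !mxE /= mul1r mul0r addr0 val_pval.
- move=> _ [x hx <-]; rewrite adapted_mxE -[a]add0r.
  by apply: (val_geM hval) => //; rewrite add0r val_ge_pval.
- move=> _ [x hx <-]; rewrite !adapted_mxE => /eqP;
    rewrite mulf_eq0 (negbTE (pval_neq0 _ _)) orbF.
  move=> /eqP ->; rewrite mul0r add0r -[b]add0r.
  by apply: (val_geM hval) => //; rewrite add0r val_ge_pval.
Qed.

End GaussianTails.

Theorem theorem1p3 (R : realType) (K : localFieldType)
    (val : K -> \bar int) (hval : is_normalized_valuation val)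
    (q : nat) (hq : is_module val q) (phi : 'rV[int]_2 -> R) :
  (exists (L : set 'rV[K]_2) (d : measure_display) (Omega : measurableType d)
          (P : probability Omega R) (X : {RV P >-> borelType K 2}),
     nondegenerate_gaussian_with_lattice val X L /\
     forall v : 'rV[int]_2, phi v = neg_log_tail val X q v)
  <->
  (exists c00 c10 c01 c11 : int,
     [/\ c00 = 0,
         c01 + c10 <= c00 + c11 &
         forall v : 'rV[int]_2,
           phi v = cube_polynomial c00%:~R c10%:~R c01%:~R c11%:~R
                     (map_mx intr v)]).
Proof.
split=> [[L [d [W [P [X [[gaussX fullL] phiE]]]]]]|].
  have [e [f [a [m [b hef]]]]] := lattice_adapted_basis hval gaussX.1 fullL.
  exists 0, a, m, (a + b); split=> // [|v].
    by have := adapted_le hef; lia.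
  by rewrite phiE (neg_log_tail_adapted hval hq v gaussX hef).
move=> [_ [a [m [c [-> supermod phiE]]]]].
(* The last coefficient has to be [a + b], which forces [b = c - a]; supermodularity then reads
   [m <= b]. *)
have mb : m <= c - a by move: supermod; lia.
pose B := adapted_mx hval a m (c - a).
have uB : B \in unitmx := adapted_mx_unit hval a m (c - a).
have [X haarX] := exists_integer_haar R hval 2 hq.
have [Y haarY] := haar_mulmx hval uB haarX.
have [latL fullL] := mulmx_lattice hval uB.
exists [set x *m B | x in rball val 0], _, _, _, Y; split=> [|v].
  by split.
have gaussY : gaussian_with_lattice val Y [set x *m B | x in rball val 0]
  by split.
rewrite phiE (neg_log_tail_adapted hval hq v gaussY (adapted_mx_basis hval a
  mb)).
by rewrite addrC subrK.
Qed.
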